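(* Let $d\in\{2,3\}$ and let $m>d$ be an integer. Then $f_{\triangle}(d,m)=dm+\lfloor m/d\rfloor\lfloor d/2\rfloor$.
   Context: All graphs are finite, simple and undirected. A graph is triangle-free if it has no three pairwise adjacent vertices. $\Delta(G)$ is the maximum degree and $\nu(G)$ the matching number of $G$. For positive integers $d,m$, $f_{\triangle}(d,m)$ is the maximum number of edges of a triangle-free graph $G$ with $\Delta(G)\le d$ and $\nu(G)\le m$. *)

(* Defs.v *)
From mathcomp Require Import all_boot.

Set Implicit Arguments.
Unset Strict Implicit.
Unset Printing Implicit Defensive.

Record sgraph := SGraph {
  vertex :> finType;
  adj : rel vertex;
  adj_sym : symmetric adj;
  adj_irrefl : irreflexive adj }.

Definition edges (G : sgraph) : {set {set G}} :=
  [set [set p.1; p.2] | p : G * G & adj p.1 p.2].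

Definition triangle_free (G : sgraph) : Prop :=
  forall x y z : G, ~ [/\ adj x y, adj y z & adj x z].

Definition degree (G : sgraph) (x : G) : nat := #|[set y | adj x y]|.

Definition max_degree (G : sgraph) : nat := \max_(x : G) degree x.

Definition matching (G : sgraph) (M : {set {set G}}) : bool :=
  (M \subset edges G) && trivIset M.

Definition matching_number (G : sgraph) : nat :=
  \max_(M : {set {set G}} | matching M) #|M|.

Definition is_maximum (S : nat -> Prop) (k : nat) : Prop :=
  S k /\ forall j, S j -> j <= k.

Definition edge_counts (d m : nat) (k : nat) : Prop :=
  exists G : sgraph,
    [/\ triangle_free G, max_degree G <= d, matching_number G <= m
      & #|edges G| = k].

(* [f_triangle_eq d m k] is the equation f_triangle(d, m) = k: it asserts both
   that the maximum defining f_triangle(d, m) exists and that it equals k. *)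
Definition f_triangle_eq (d m k : nat) : Prop :=
  is_maximum (edge_counts d m) k.

(* Main.v *)
Require Import Defs.
From mathcomp Require Import all_boot.
From mathcomp Require Import zify.

(** Upper bound, for every d: let F m = d m + (m / d)(d / 2), which is
    superadditive.  By Gallai, a vertex set S either has a vertex lying in all of
    its maximum matchings, or splits into two parts joined by no edge, or
    satisfies |S| <= 2 nu(S) + 1.  In the first case deleting the vertex loses at
    most d edges and lowers nu, in the second both parts are smaller; in the last
    the bound F (nu S) follows from the degree bound if nu(S) >= d, and from
    Mantel's theorem if nu(S) < d.

    Lower bound, for every d >= 2: replacing two adjacent vertices of the pentagon
    by d - 1 copies each gives a triangle-free graph with maximum degree d on
    2d + 1 vertices with d^2 + 1 edges.  Taking m / d disjoint copies of it and
    one K_{r,d} with r = m mod d yields d m + m / d edges, which is F m exactly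
    when d / 2 = 1. *)

Set Implicit Arguments.
Unset Strict Implicit.
Unset Printing Implicit Defensive.

Definition superadditive (F : nat -> nat) := forall a b, F a + F b <= F (a + b).

Lemma superadditive_homo F : superadditive F -> {homo F : a b / a <= b}.
Proof.
by move=> superF a b /subnKC <-; apply: leq_trans (superF _ _); apply: leq_addr.
Qed.

Lemma exists_setD_neq (T : finType) (A B : {set T}) w :
  #|A| = #|B| -> 1 < #|B :\: A| -> exists2 x, x \in A :\: B & x != w.
Proof.
move=> eqAB; have -> : #|B :\: A| = #|A :\: B| by rewrite !cardsD eqAB setIC.
case/card_gt1P=> x [y [xAB yAB neq_xy]].
have [eq_xw|] := eqVneq x w; last by exists x.
by exists y; rewrite // -eq_xw eq_sym.
Qed.

(** * Edges inside a vertex set *)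

Section Edges.
Variable G : sgraph.
Implicit Types (A S : {set G}) (v x y : G).

Definition edges_in S : {set {set G}} := [set A in edges G | A \subset S].

Definition neighbours_in S x : {set G} := [set y in S | adj x y].

Lemma adj_neq x y : adj x y -> x != y.
Proof. by apply: contraTneq => ->; rewrite adj_irrefl. Qed.

Lemma edgesP A : reflect (exists x y, adj x y /\ A = [set x; y]) (A \in edges G).
Proof.
apply: (iffP imsetP) => [[[x y]]|[x [y [xy ->]]]]; rewrite ?inE /=.
  by move=> xy ->; exists x, y.
by exists (x, y); rewrite ?inE.
Qed.

Lemma mem_edges x y : adj x y -> [set x; y] \in edges G.
Proof. by move=> xy; apply/edgesP; exists x, y. Qed.

Lemma card_edge A : A \in edges G -> #|A| = 2.
Proof. by case/edgesP=> x [y [xy ->]]; rewrite cards2 adj_neq. Qed.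

Lemma edge_incident v A : A \in edges G -> v \in A ->
  exists2 y, adj v y & A = [set v; y].
Proof.
case/edgesP=> x [y [xy ->]]; rewrite !inE => /orP[]/eqP->; first by exists y.
by exists x; rewrite 1?adj_sym // setUC.
Qed.

Lemma edges_inT : edges_in setT = edges G.
Proof. by apply/setP => A; rewrite inE subsetT andbT. Qed.

Lemma card_neighbours_inT x : #|neighbours_in setT x| = degree x.
Proof. by rewrite /degree; apply: eq_card => y; rewrite !inE. Qed.

Lemma leq_card_neighbours_in S x : #|neighbours_in S x| <= max_degree G.
Proof.
rewrite (leq_trans _ (leq_bigmax x)) // subset_leq_card //.
by apply/subsetP => y; rewrite !inE => /andP[].
Qed.

Lemma card_neighbours_inD1 S v x : v \in S ->
  #|neighbours_in S x| = adj x v + #|neighbours_in (S :\ v) x|.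
Proof.
move=> vS; rewrite (cardsD1 v) inE vS; congr (_ + _).
by apply: eq_card => y; rewrite !inE andbA.
Qed.

Lemma card_edges_inD1 S v : v \in S ->
  #|edges_in S| = #|edges_in (S :\ v)| + #|neighbours_in S v|.
Proof.
move=> vS; rewrite -(cardsID [set A : {set G} | v \in A]) addnC; congr (_ + _).
  by apply: eq_card => A; rewrite !inE subsetD1 andbC andbA.
have inj_edge : {in neighbours_in S v &, injective (fun y => [set v; y])}.
  move=> y z; rewrite !inE => /andP[_ /adj_neq vy] _ /setP/(_ y).
  by rewrite !inE eqxx orbT eq_sym (negbTE vy) => /esym/eqP.
rewrite -(card_in_imset inj_edge); apply: eq_card => A; rewrite !inE.
apply/andP/imsetP => [[/andP[edgeA sAS] vA]|[y]].
  have [y vy defA] := edge_incident edgeA vA; exists y => //.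
  by rewrite inE vy (subsetP sAS) // defA !inE eqxx orbT.
by rewrite inE => /andP[yS vy] ->; rewrite mem_edges // subUset !sub1set vS yS set21.
Qed.

Lemma handshake_in S : \sum_(x in S) #|neighbours_in S x| = (#|edges_in S|).*2.
Proof.
have [n] := ubnP #|S|; elim: n S => // n IHn S le_n.
have [->|[v vS]] := set_0Vmem S.
  rewrite big_set0 eq_card0 // => A; rewrite !inE subset0.
  by apply/andP => -[/card_edge + /eqP A0]; rewrite A0 cards0.
have ltS : #|S :\ v| < n by move: le_n; rewrite (cardsD1 v) vS.
have sum_adj_v : \sum_(x in S :\ v) adj x v = #|neighbours_in S v|.
  rewrite (card_neighbours_inD1 _ vS) adj_irrefl add0n -sum1_card.
  rewrite big_mkcond [RHS]big_mkcond; apply: eq_bigr => x _.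
  by rewrite !inE adj_sym; case: (_ \in S); case: eqP; case: adj.
rewrite (big_setD1 v) //=; under eq_bigr do rewrite (card_neighbours_inD1 _ vS).
rewrite big_split /= sum_adj_v IHn // (card_edges_inD1 vS) doubleD.
by rewrite addnA addnn addnC.
Qed.

Lemma handshake : \sum_(x : G) degree x = (#|edges G|).*2.
Proof.
rewrite -edges_inT -handshake_in; apply: eq_big => [x|x _]; first by rewrite inE.
by rewrite card_neighbours_inT.
Qed.

Lemma leq_card_edges_in_max_degree S : (#|edges_in S|).*2 <= max_degree G * #|S|.
Proof.
rewrite -handshake_in mulnC -sum_nat_const.
by apply: leq_sum => x _; apply: leq_card_neighbours_in.
Qed.

Lemma mantel S : triangle_free G -> 4 * #|edges_in S| <= #|S| ^ 2.
Proof.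
move=> tfG; have [n] := ubnP #|S|; elim: n S => // n IHn S le_n.
have [->|[A]] := set_0Vmem (edges_in S); first by rewrite cards0 muln0.
rewrite inE => /andP[/edgesP[x [y [xy ->]]]]; rewrite subUset !sub1set => /andP[xS yS].
have ySx : y \in S :\ x by rewrite !inE eq_sym adj_neq.
have disjN : [disjoint neighbours_in S x & neighbours_in S y].
  apply/pred0P => z; rewrite /= !inE; apply/negP => /andP[/andP[_ xz] /andP[_ yz]].
  by case: (tfG x y z).
have le_degrees : #|neighbours_in S x| + #|neighbours_in S y| <= #|S|.
  have /leqifP := leq_card_setU (neighbours_in S x) (neighbours_in S y).
  rewrite disjN => /eqP <-; apply: subset_leq_card.
  by apply/subsetP => z; rewrite !inE => /orP[]/andP[].
have cardS : #|S| = (#|S :\ x :\ y|).+2 by rewrite (cardsD1 x) xS (cardsD1 y) ySx.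
have := card_neighbours_inD1 y xS; rewrite adj_sym xy => deg_y.
have ltS : #|S :\ x :\ y| < n by lia.
have := IHn _ ltS; rewrite (card_edges_inD1 xS) (card_edges_inD1 ySx); nia.
Qed.

End Edges.

(** * Maximum matchings and Gallai's lemma *)

Section Matchings.
Variable G : sgraph.
Implicit Types (A B C S : {set G}) (M N : {set {set G}}) (u v w x y : G).

Definition matching_in S M := matching M && (cover M \subset S).

Definition matching_number_in S := \max_(M | matching_in S M) #|M|.

Definition maximum_matching S M :=
  matching_in S M && (#|M| == matching_number_in S).

Definition essential S v := [forall (M | maximum_matching S M), v \in cover M].

Definition linked S u v :=
  [forall (M | maximum_matching S M), (u \in cover M) || (v \in cover M)].

Lemma matching_trivIset M : matching M -> trivIset M.
Proof. by case/andP. Qed.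

Lemma matching_edge M A : matching M -> A \in M -> A \in edges G.
Proof. by case/andP=> /subsetP sM _; apply: sM. Qed.

Lemma mem_cover M A x : A \in M -> x \in A -> x \in cover M.
Proof. by move=> AM xA; apply/bigcupP; exists A. Qed.

Lemma card_cover_matching M : matching M -> #|cover M| = (#|M|).*2.
Proof.
move=> mM; rewrite -sum1_card big_trivIset ?matching_trivIset //=.
rewrite -muln2 -sum_nat_const; apply: eq_bigr => A AM.
by rewrite sum1_card card_edge // (matching_edge mM).
Qed.

Lemma matching0 : matching (set0 : {set {set G}}).
Proof. by rewrite /matching sub0set; apply/trivIsetP => A B; rewrite inE. Qed.

Lemma matchingU M N : matching M -> matching N -> [disjoint cover M & cover N] ->
  matching (M :|: N).
Proof.
case/andP=> sM tM /andP[sN tN] dMN.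
by rewrite /matching subUset sM sN trivIsetU.
Qed.

Lemma matching1 x y : adj x y -> matching [set [set x; y]].
Proof. by move=> xy; rewrite /matching sub1set mem_edges // trivIset1. Qed.

Lemma matchingD1 M A : matching M -> matching (M :\ A).
Proof.
by case/andP=> sM tM; rewrite /matching (subset_trans (subsetDl _ _) sM) trivIsetD.
Qed.

Lemma coverU M N : cover (M :|: N) = cover M :|: cover N.
Proof. exact: bigcup_setU. Qed.

Lemma card_matchingU M N : matching M -> matching N ->
  [disjoint cover M & cover N] -> #|M :|: N| = #|M| + #|N|.
Proof.
move=> mM mN dMN; apply: double_inj.
rewrite doubleD -!card_cover_matching ?matchingU // coverU.
by rewrite cardsU disjoint_setI0 // cards0 subn0.
Qed.

Lemma matching_mate M x : matching M -> x \in cover M ->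
  exists2 y, adj x y & [set x; y] \in M.
Proof.
move=> mM /bigcupP[A AM xA].
have [y xy defA] := edge_incident (matching_edge mM AM) xA.
by exists y; rewrite -?defA.
Qed.

Lemma matching_add_edge M x y : matching M -> adj x y ->
    x \notin cover M -> y \notin cover M ->
  matching ([set x; y] |: M) /\ #|[set x; y] |: M| = #|M|.+1.
Proof.
move=> mM xy xM yM; have mxy := matching1 xy.
have dxy : [disjoint cover [set [set x; y]] & cover M].
  rewrite cover1 disjoints_subset; apply/subsetP => z.
  by rewrite !inE => /orP[]/eqP->.
by rewrite matchingU // card_matchingU // cards1.
Qed.

Lemma matching_exchange M A x y : matching M -> A \in M -> y \in A ->
    adj x y -> x \notin cover M ->
  matching ([set x; y] |: M :\ A) /\ #|[set x; y] |: M :\ A| = #|M|.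
Proof.
move=> mM AM yA xy xM; have cD1 := coverD1 (matching_trivIset mM) AM.
rewrite (cardsD1 A M) AM; apply: matching_add_edge; rewrite ?matchingD1 //.
  by rewrite cD1 inE (negbTE xM) andbF.
by rewrite cD1 inE yA.
Qed.

Lemma maximum_matchingP {S M} :
  reflect [/\ matching M, cover M \subset S & #|M| = matching_number_in S]
          (maximum_matching S M).
Proof.
by apply: (iffP andP) => [[/andP[mM sM] /eqP]|[mM sM ->]] //; rewrite /matching_in mM.
Qed.

Lemma maximum_matching_exists S : exists M, maximum_matching S M.
Proof.
have in0 : matching_in S set0.
  by rewrite /matching_in matching0 /cover big_set0 sub0set.
have [] := arg_maxnP (fun M => #|M|) in0; move=> M mM maxM; exists M.
rewrite /maximum_matching mM eqn_leq leq_bigmax_cond //=.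
by apply/bigmax_leqP.
Qed.

Lemma matching_number_inT : matching_number_in setT = matching_number G.
Proof. by apply: eq_bigl => M; rewrite /matching_in subsetT andbT. Qed.

Lemma leq_matching_number_in S M : matching_in S M -> #|M| <= matching_number_in S.
Proof. exact: leq_bigmax_cond. Qed.

Lemma leq_matching_number_inU A B : [disjoint A & B] ->
  matching_number_in A + matching_number_in B <= matching_number_in (A :|: B).
Proof.
move=> dAB; have [M /maximum_matchingP[mM sM <-]] := maximum_matching_exists A.
have [N /maximum_matchingP[mN sN <-]] := maximum_matching_exists B.
have dMN : [disjoint cover M & cover N] by apply: disjointWl sM (disjointWr sN dAB).
rewrite -card_matchingU // leq_matching_number_in //.
by rewrite /matching_in matchingU // coverU setUSS.
Qed.

Lemma leq_double_matching_number : (matching_number G).*2 <= #|G|.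
Proof.
have [M /maximum_matchingP[mM _]] := maximum_matching_exists setT.
by rewrite matching_number_inT => <-; rewrite -card_cover_matching // max_card.
Qed.

Lemma leq_matching_number_vertex_cover C :
    (forall x y, adj x y -> (x \in C) || (y \in C)) -> matching_number G <= #|C|.
Proof.
move=> coverC; apply/bigmax_leqP => M mM.
apply: leq_trans (_ : #|cover M :&: C| <= _); last by rewrite subset_leq_card ?subsetIr.
rewrite -sum1_card -[leqRHS]sum1_card; under [leqRHS]eq_bigl do rewrite inE.
rewrite big_trivIset_cond ?matching_trivIset //=; apply: leq_sum => A AM.
have /edgesP[x [y [/coverC xyC ->]]] := matching_edge mM AM.
have [z zxy zC] : exists2 z, z \in [set x; y] & z \in C.
  by case/orP: xyC => ?; [exists x | exists y]; rewrite ?set21 ?set22.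
by rewrite (bigD1 z) // zxy.
Qed.

Lemma ltn_matching_number_in_essential S v : essential S v ->
  matching_number_in (S :\ v) < matching_number_in S.
Proof.
move=> /forall_inP ess.
have [M /maximum_matchingP[mM]] := maximum_matching_exists (S :\ v).
rewrite subsetD1 => /andP[sM vM] <-.
have inM : matching_in S M by rewrite /matching_in mM.
rewrite ltn_neqAle leq_matching_number_in // andbT; apply: contra vM => maxM.
by apply: ess; rewrite /maximum_matching inM.
Qed.

Lemma linkedP S u v : reflect
  (forall M, maximum_matching S M -> u \notin cover M -> v \in cover M) (linked S u v).
Proof.
apply: (iffP forall_inP) => [uv M maxM /negbTE uM|uv M maxM].
  by have := uv M maxM; rewrite uM.
by rewrite -implyNb; apply/implyP/uv.
Qed.

Lemma linked_adj S u v : u \in S -> v \in S -> adj u v -> linked S u v.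
Proof.
move=> uS vS uv; apply/linkedP => M /maximum_matchingP[mM sM cardM] uM.
apply: contraT => vM; have [mM' cardM'] := matching_add_edge mM uv uM vM.
have := @leq_matching_number_in S ([set u; v] |: M).
rewrite cardM' cardM ltnn => -> //.
by rewrite /matching_in mM' coverU cover1 !subUset !sub1set uS vS.
Qed.

Lemma maximum_matching_exchange S M A x y : maximum_matching S M ->
    A \in M -> y \in A -> x \in S -> adj x y -> x \notin cover M ->
  maximum_matching S ([set x; y] |: M :\ A).
Proof.
case/maximum_matchingP=> mM sM cardM AM yA xS xy xM.
have [mM' cardM'] := matching_exchange mM AM yA xy xM.
apply/maximum_matchingP; split; rewrite ?cardM' //.
rewrite coverU cover1 !subUset !sub1set xS (subsetP sM) ?(mem_cover AM) //=.
by rewrite coverD1 ?matching_trivIset // (subset_trans (subsetDl _ _) sM).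
Qed.

Lemma maximum_matching_closer S M N x w :
    maximum_matching S M -> maximum_matching S N ->
    x \in cover M -> x \notin cover N -> w \notin cover N -> w != x ->
  exists N', [/\ maximum_matching S N', w \notin cover N' & #|M :&: N| < #|M :&: N'|].
Proof.
case/maximum_matchingP=> mM sM _ maxN xM xN wN neq_wx.
have tM := matching_trivIset mM; have [mN _ _] := maximum_matchingP maxN.
have [y xy xyM] := matching_mate mM xM.
have [xS yS] : x \in S /\ y \in S.
  by split; apply: (subsetP sM); apply: mem_cover xyM _; rewrite !inE eqxx ?orbT.
have yN : y \in cover N by have /linkedP := linked_adj xS yS xy; apply.
have [A AN yA] := bigcupP yN.
have AM : A \notin M.
  apply/negP => AM; case/negP: xN; apply: mem_cover AN _.
  by rewrite -(def_pblock tM AM yA) (def_pblock tM xyM) ?set21 ?set22.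
exists ([set x; y] |: N :\ A); split.
- exact: maximum_matching_exchange.
- rewrite coverU cover1 (coverD1 (matching_trivIset mN) AN) !inE (negbTE wN) andbF orbF.
  by rewrite negb_or neq_wx; apply: contraNneq wN => ->.
apply: proper_card; apply/properP; split.
  apply/subsetP => B; rewrite !inE => /andP[BM BN]; rewrite BM BN andbT /=.
  by apply/orP; right; apply: contraNneq AM => <-.
exists [set x; y]; first by rewrite !inE xyM eqxx.
by rewrite inE xyM; apply: contra xN => xyN; apply: mem_cover xyN _; rewrite set21.
Qed.

(* Gallai's lemma: were M to miss both u and v, a maximum matching missing w and
   sharing as many edges as possible with M could be moved closer to M. *)
Lemma linked_trans S u v w : u != v -> ~~ essential S w ->
  linked S u w -> linked S w v -> linked S u v.
Proof.
move=> neq_uv /forall_inPn[N0 maxN0 wN0] /linkedP uw /linkedP wv.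
apply/linkedP => M maxM uM; apply: contraT => vM.
pose misses_w N := maximum_matching S N && (w \notin cover N).
have [] := @arg_maxnP _ N0 misses_w (fun N => #|M :&: N|); first exact/andP.
move=> N /andP[maxN wN] closestN.
have vN : v \in cover N by apply: wv.
have uN : u \in cover N by apply: contraT => /(uw _ maxN); rewrite (negbTE wN).
have [x] : exists2 x, x \in cover M :\: cover N & x != w.
  apply: exists_setD_neq.
    have [mM _ cardM] := maximum_matchingP maxM.
    have [mN _ cardN] := maximum_matchingP maxN.
    by rewrite !card_cover_matching // cardM cardN.
  by apply/card_gt1P; exists u, v; rewrite !inE uM uN vM vN.
rewrite inE eq_sym => /andP[xN xM] neq_wx.
have [N' [maxN' wN']] := maximum_matching_closer maxM maxN xM xN wN neq_wx.
have le_NN' : #|M :&: N'| <= #|M :&: N| by apply: closestN; rewrite /misses_w maxN'.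
by rewrite ltnNge le_NN'.
Qed.

Lemma leq_card_linked S : {in S &, forall u v, (u == v) || linked S u v} ->
  #|S| <= (matching_number_in S).*2.+1.
Proof.
move=> all_linked; have [M maxM] := maximum_matching_exists S.
have [mM sM <-] := maximum_matchingP maxM.
rewrite -card_cover_matching // -(cardsID (cover M) S) (setIidPr sM) -addn1.
rewrite leq_add2l; apply/card_le1_eqP => u v; rewrite !inE.
move=> /andP[uM uS] /andP[vM vS]; have /orP[/eqP //|] := all_linked u v uS vS.
by move/linkedP/(_ M maxM uM); rewrite (negbTE vM).
Qed.

(* The sets A and S :\: A are unions of classes of the relation
   "equal or linked", an equivalence by Gallai's lemma. *)
Lemma unlinked_separation S u v : {in S, forall w, ~~ essential S w} ->
    u \in S -> v \in S -> u != v -> ~~ linked S u v ->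
  exists A, [/\ A \proper S, A != set0 & {in A & S :\: A, forall x y, ~~ adj x y}].
Proof.
move=> nessS uS vS neq_uv nlinked_uv.
pose A := [set w in S | (w == u) || linked S u w].
have uA : u \in A by rewrite inE uS eqxx.
exists A; split; last 1 first.
- move=> x y xA; rewrite inE => /andP[yA yS]; apply: contra yA => xy.
  move: xA; rewrite !inE yS => /andP[xS xA].
  have xy_linked := linked_adj xS yS xy.
  have [//|neq_yu] := eqVneq y u; case/orP: xA => [/eqP <- //|ux_linked].
  by apply: linked_trans ux_linked xy_linked; rewrite 1?eq_sym ?nessS.
- apply/properP; split; first by apply/subsetP => w; rewrite inE => /andP[].
  by exists v; rewrite // inE vS eq_sym (negbTE neq_uv).
- by apply/set0Pn; exists u.
Qed.

Lemma gallai_decomposition S :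
  [\/ exists2 v, v \in S & essential S v,
      #|S| <= (matching_number_in S).*2.+1
    | exists A, [/\ A \proper S, A != set0
        & {in A & S :\: A, forall x y, ~~ adj x y}]].
Proof.
have [/exists_inP|/exists_inPn nessS] := boolP [exists v in S, essential S v].
  by constructor 1.
have [/forall_inP all_linked|] :=
  boolP [forall u in S, forall v in S, (u == v) || linked S u v].
  constructor 2; apply: leq_card_linked => u v uS.
  by move: v; apply/forall_inP/all_linked.
case/forall_inPn=> u uS /forall_inPn[v vS]; rewrite negb_or => /andP[neq_uv nlinked_uv].
by constructor 3; apply: unlinked_separation neq_uv nlinked_uv.
Qed.

Lemma leq_card_edges_in_separation A S : {in A & S :\: A, forall x y, ~~ adj x y} ->
  #|edges_in S| <= #|edges_in A| + #|edges_in (S :\: A)|.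
Proof.
move=> sepA; apply: leq_trans (leq_card_setU _ _); apply: subset_leq_card.
apply/subsetP => B; rewrite !inE => /andP[edgeB]; rewrite edgeB /=.
have /edgesP[x [y [xy ->]]] := edgeB; rewrite !subUset !sub1set !inE => /andP[xS yS].
move: (sepA x y) (sepA y x); rewrite !inE [adj y x]adj_sym xy xS yS.
case: (x \in A); case: (y \in A) => //=.
  by move=> /(_ isT isT).
by move=> _ /(_ isT isT).
Qed.

Lemma card_edges_leq_matching_number (F : nat -> nat) :
    superadditive F -> max_degree G <= F 1 ->
    (forall S, #|edges_in S| <= F #|S|./2) ->
  #|edges G| <= F (matching_number G).
Proof.
move=> superF degF halfF; have homoF := superadditive_homo superF.
rewrite -edges_inT -matching_number_inT.
have [n] := ubnP #|[set: G]|; elim: n [set: G] => // n IHn S le_n.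
have {}IHn A : A \proper S -> #|edges_in A| <= F (matching_number_in A).
  by move/proper_card=> ltA; apply: IHn; apply: leq_trans ltA le_n.
have [[v vS essv]|leS|[A [properA A0 sepA]]] := gallai_decomposition S.
- rewrite (card_edges_inD1 vS).
  apply: leq_trans (leq_add (IHn _ (properD1 vS)) (leq_card_neighbours_in _ _)) _.
  apply: leq_trans (leq_add (leqnn _) degF) (leq_trans (superF _ _) _).
  by rewrite homoF // addn1 ltn_matching_number_in_essential.
- by apply: leq_trans (halfF S) (homoF _ _ _); rewrite leq_half_double.
have sAS := proper_sub properA.
have properSA : S :\: A \proper S.
  rewrite properEneq subsetDl andbT; apply: contraNneq A0 => eqS.
  by rewrite -(setIidPr sAS) -eqS setIDAC setDIl setDv setI0.
apply: leq_trans (leq_card_edges_in_separation sepA) _.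
apply: leq_trans (leq_add (IHn _ properA) (IHn _ properSA)) _.
apply: leq_trans (superF _ _) (homoF _ _ _).
have defS : A :|: (S :\: A) = S by rewrite -{1}(setIidPr sAS) setID.
by rewrite -{2}defS leq_matching_number_inU // disjoints_subset setCD subsetUr.
Qed.

End Matchings.

(** * The upper bound *)

Definition edge_bound d m := d * m + m %/ d * (d %/ 2).

Lemma edge_bound_superadditive d : superadditive (edge_bound d).
Proof.
move=> a b; rewrite /edge_bound mulnDr addnACA leq_add2l -mulnDl leq_mul2r.
case: d => [|d]; first by rewrite !divn0.
by rewrite divnD // leq_addr orbT.
Qed.

Lemma leq_card_edges_in_half (G : sgraph) d (S : {set G}) :
    triangle_free G -> max_degree G <= d ->
  #|edges_in S| <= edge_bound d #|S|./2.
Proof.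
move=> tfG degG; have := mantel S tfG.
have := leq_trans (leq_card_edges_in_max_degree S) (leq_mul degG (leqnn #|S|)).
move: #|edges_in S| #|S| => e s; set k := s./2.
have le_s : s <= k.*2.+1 by rewrite -leq_half_double.
have [lt_kd _ mantel_e|le_dk deg_e _] := ltnP k d.
  have le_e : e <= k * k.+1.
    by have := leq_trans mantel_e (leq_mul le_s le_s); nia.
  by apply: leq_trans le_e (leq_trans _ (leq_addr _ _)); rewrite mulnC leq_mul.
have le_e : e <= d * k + d %/ 2.
  by have := leq_trans deg_e (leq_mul (leqnn d) le_s); nia.
have [d0|d_gt0] := posnP d; first by move: deg_e; rewrite d0; case: e {le_e}.
by apply: leq_trans le_e _; rewrite leq_add2l leq_pmull // divn_gt0.
Qed.

Theorem card_edges_upper_bound (G : sgraph) d m :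
    triangle_free G -> max_degree G <= d -> matching_number G <= m ->
  #|edges G| <= edge_bound d m.
Proof.
move=> tfG degG /(superadditive_homo (@edge_bound_superadditive d)).
apply: leq_trans; apply: card_edges_leq_matching_number.
- exact: edge_bound_superadditive.
- by rewrite /edge_bound muln1 (leq_trans degG) ?leq_addr.
- by move=> S; apply: leq_card_edges_in_half.
Qed.

(** * Disjoint unions and blow-ups *)

Section DisjointUnion.
Variables G H : sgraph.

Definition sum_adj (x y : G + H) : bool :=
  match x, y with
  | inl a, inl b => adj a b
  | inr a, inr b => adj a b
  | _, _ => false
  end.

Lemma sum_adj_sym : symmetric sum_adj.
Proof. by move=> [a|a] [b|b] //=; rewrite adj_sym. Qed.

Lemma sum_adj_irrefl : irreflexive sum_adj.
Proof. by move=> [a|a] /=; rewrite adj_irrefl. Qed.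

Definition sum_graph := SGraph sum_adj_sym sum_adj_irrefl.

Lemma degree_inl (x : G) : degree (inl x : sum_graph) = degree x.
Proof. by rewrite /degree -!sum1dep_card big_sumType /= addnC big1. Qed.

Lemma degree_inr (x : H) : degree (inr x : sum_graph) = degree x.
Proof. by rewrite /degree -!sum1dep_card big_sumType /= big1. Qed.

Lemma card_edges_sum : #|edges sum_graph| = #|edges G| + #|edges H|.
Proof.
apply: double_inj; rewrite doubleD -!handshake big_sumType /=.
by congr (_ + _); apply: eq_bigr => x _; rewrite ?degree_inl ?degree_inr.
Qed.

Lemma max_degree_sum : max_degree sum_graph = maxn (max_degree G) (max_degree H).
Proof.
rewrite /max_degree big_sumType /=.
by congr maxn; apply: eq_bigr => x _; rewrite ?degree_inl ?degree_inr.
Qed.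

Lemma triangle_free_sum :
  triangle_free G -> triangle_free H -> triangle_free sum_graph.
Proof.
move=> tfG tfH [x|x] [y|y] [z|z] [] //= xy yz xz; first exact: (tfG x y z).
exact: (tfH x y z).
Qed.

End DisjointUnion.

Lemma matching_preimage (G H : sgraph) (f : G -> H) (M : {set {set H}}) :
    injective f -> {mono f : x y / adj x y} -> matching M ->
  matching [set A : {set G} | f @: A \in M].
Proof.
move=> f_inj f_adj /andP[sM tM]; apply/andP; split.
  apply/subsetP => A; rewrite inE => /(subsetP sM)/edgesP[x [y [xy defA]]].
  have /imsetP[a _ xa] : x \in f @: A by rewrite defA set21.
  have /imsetP[b _ yb] : y \in f @: A by rewrite defA set22.
  rewrite {}xa {}yb in xy defA; apply/edgesP; exists a, b; rewrite -f_adj; split=> //.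
  by apply: (imset_inj f_inj); rewrite defA imsetU !imset_set1.
rewrite -(imset_trivIset _ f_inj); apply: trivIsetS tM.
by apply/subsetP => _ /imsetP[A + ->]; rewrite inE.
Qed.

Lemma leq_matching_number_sum (G H : sgraph) :
  matching_number (sum_graph G H) <= matching_number G + matching_number H.
Proof.
apply/bigmax_leqP => M mM.
pose MG := [set A : {set G} | (@inl G H) @: A \in M].
pose MH := [set A : {set H} | (@inr G H) @: A \in M].
have mMG : matching MG by apply: (@matching_preimage G (sum_graph G H)) => // x y [].
have mMH : matching MH by apply: (@matching_preimage H (sum_graph G H)) => // x y [].
apply: leq_trans (leq_add (leq_bigmax_cond _ mMG) (leq_bigmax_cond _ mMH)).
rewrite -(card_imset MG (imset_inj (@inl_inj G H))).
rewrite -(card_imset MH (imset_inj (@inr_inj G H))).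
apply: leq_trans (leq_card_setU _ _); apply: subset_leq_card.
apply/subsetP => A AM; have /edgesP[x [y [xy defA]]] := matching_edge mM AM.
rewrite inE; case: x y xy defA => [x|x] [y|y] //= _ defA; apply/orP; [left | right].
  by apply/imsetP; exists [set x; y]; rewrite ?inE imsetU !imset_set1 -?defA.
by apply/imsetP; exists [set x; y]; rewrite ?inE imsetU !imset_set1 -?defA.
Qed.

Lemma edge_countsD d m n k l :
  edge_counts d m k -> edge_counts d n l -> edge_counts d (m + n) (k + l).
Proof.
move=> [G [tfG degG mG <-]] [H [tfH degH mH <-]]; exists (sum_graph G H); split.
- exact: triangle_free_sum.
- by rewrite max_degree_sum geq_max degG.
- exact: leq_trans (leq_matching_number_sum G H) (leq_add mG mH).
- exact: card_edges_sum.
Qed.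

Section BlowUp.
Variables (G : sgraph) (w : G -> nat).

Definition blow_up_adj (u v : {x : G & 'I_(w x)}) : bool := adj (tag u) (tag v).

Lemma blow_up_adj_sym : symmetric blow_up_adj.
Proof. by move=> u v; apply: adj_sym. Qed.

Lemma blow_up_adj_irrefl : irreflexive blow_up_adj.
Proof. by move=> u; apply: adj_irrefl. Qed.

Definition blow_up := SGraph blow_up_adj_sym blow_up_adj_irrefl.

Lemma sum_blow_up (P : pred G) (F : G -> nat) :
  \sum_(u : blow_up | P (tag u)) F (tag u) = \sum_(x | P x) w x * F x.
Proof.
transitivity (\sum_(x | P x) \sum_(i < w x) F x).
  by rewrite sig_big_dep /=; apply: eq_bigl => u; rewrite andbT.
by apply: eq_bigr => x _; rewrite sum_nat_const card_ord.
Qed.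

Lemma card_blow_up (P : pred G) :
  #|[set u : blow_up | P (tag u)]| = \sum_(x | P x) w x.
Proof.
rewrite -sum1dep_card (sum_blow_up P (fun=> 1)).
by apply: eq_bigr => x _; rewrite muln1.
Qed.

Lemma degree_blow_up (u : blow_up) : degree u = \sum_(y | adj (tag u) y) w y.
Proof. exact: card_blow_up. Qed.

Lemma card_edges_blow_up :
  (#|edges blow_up|).*2 = \sum_x w x * \sum_(y | adj x y) w y.
Proof.
rewrite -handshake -(sum_blow_up xpredT (fun x => \sum_(y | adj x y) w y)).
by apply: eq_bigr => u _; rewrite degree_blow_up.
Qed.

Lemma triangle_free_blow_up : triangle_free G -> triangle_free blow_up.
Proof. by move=> tfG u v t; apply: tfG. Qed.

End BlowUp.

(** * The lower bound *)

Definition single_edge := SGraph addbC addbb.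

Lemma sum_single_edge (F : bool -> nat) (x : single_edge) :
  \sum_(y | adj x y) F y = F (~~ x).
Proof. by apply: big_pred1 => y; case: x y => -[]. Qed.

Definition complete_bipartite r s :=
  blow_up (fun b : single_edge => if b then r else s).

Lemma edge_counts_complete_bipartite r d : r <= d -> edge_counts d r (d * r).
Proof.
move=> le_rd; exists (complete_bipartite r d); split.
- by apply: triangle_free_blow_up => -[] [] [] [].
- apply/bigmax_leqP => u _; rewrite degree_blow_up sum_single_edge.
  by case: (tag u).
- pose side := [set u : complete_bipartite r d | tag u].
  have card_side : #|side| = r.
    by rewrite (@card_blow_up single_edge _ id) (big_pred1 true) //; case.
  rewrite -[leqRHS]card_side; apply: leq_matching_number_vertex_cover => u v.
  by rewrite /= /blow_up_adj !inE /=; case: (tag u) (tag v) => -[].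
apply: double_inj; rewrite card_edges_blow_up.
under eq_bigr do rewrite sum_single_edge.
by rewrite big_bool /= [r * d]mulnC addnn.
Qed.

Definition pentagon_adj (x y : 'I_5) := (y == ordS x) || (x == ordS y).

Lemma pentagon_adj_sym : symmetric pentagon_adj.
Proof. by move=> x y; apply: orbC. Qed.

Lemma pentagon_adj_irrefl : irreflexive pentagon_adj.
Proof. by case=> -[|[|[|[|[|x]]]]] //. Qed.

Definition pentagon := SGraph pentagon_adj_sym pentagon_adj_irrefl.

Lemma triangle_free_pentagon : triangle_free pentagon.
Proof. by do 3![case=> -[|[|[|[|[|?]]]]] // ?] => -[]. Qed.

Lemma sum_pentagon (F : 'I_5 -> nat) (x : pentagon) :
  \sum_(y | adj x y) F y = F (ordS x) + F (ord_pred x).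
Proof.
have neq_neighbours : ord_pred x != ordS x.
  by case: x => -[|[|[|[|[|x]]]]].
rewrite (bigD1 (ordS x)) /= /pentagon_adj ?eqxx //; congr (_ + _).
apply: big_pred1 => y; rewrite [x == _]eq_sym (can2_eq (@ordSK 5) (@ord_predK 5)).
have [->|_] := eqVneq y (ordS x); last by rewrite andbT.
by rewrite andbF /= eq_sym (negbTE neq_neighbours).
Qed.

Definition pentagon_weight d (x : pentagon) := if x < 2 then d.-1 else 1.

Lemma edge_counts_pentagon d : 1 < d -> edge_counts d d (d * d).+1.
Proof.
case: d => // d d_gt0; exists (blow_up (pentagon_weight d.+1)); split.
- exact/triangle_free_blow_up/triangle_free_pentagon.
- apply/bigmax_leqP => u _; rewrite degree_blow_up sum_pentagon /pentagon_weight.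
  by case: (tag u) => -[|[|[|[|[|x]]]]] //= _; lia.
- rewrite -ltnS -ltn_double; apply: leq_ltn_trans (leq_double_matching_number _) _.
  rewrite -cardsT (card_blow_up (pentagon_weight d.+1) xpredT).
  rewrite !big_ord_recl big_ord0 /pentagon_weight /=; lia.
apply: double_inj; rewrite card_edges_blow_up.
under eq_bigr do rewrite sum_pentagon.
rewrite !big_ord_recl big_ord0 /pentagon_weight /=; lia.
Qed.

Lemma edge_countsMl d m k n : edge_counts d m k -> edge_counts d (n * m) (n * k).
Proof.
move=> mk; elim: n => [|n IHn]; last by rewrite !mulSn; apply: edge_countsD.
by have := edge_counts_complete_bipartite (leq0n d); rewrite muln0.
Qed.

Theorem edge_counts_lower_bound d m : 1 < d -> edge_counts d m (d * m + m %/ d).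
Proof.
move=> d_gt1; have le_rd : m %% d <= d by rewrite ltnW // ltn_mod ltnW.
have := edge_countsD (edge_countsMl (m %/ d) (edge_counts_pentagon d_gt1))
                     (edge_counts_complete_bipartite le_rd).
rewrite -divn_eq; congr edge_counts.
by rewrite {3}(divn_eq m d) mulnDr mulnCA mulnS -addnA addnC.
Qed.

Theorem theorem6 (d m : nat) (hd : d = 2 \/ d = 3) (hm : d < m) :
  f_triangle_eq d m (d * m + (m %/ d) * (d %/ 2)).
Proof.
have [d_gt1 d_half] : 1 < d /\ d %/ 2 = 1 by case: hd => ->.
split; last by move=> _ [G [tfG degG mG <-]]; apply: card_edges_upper_bound.
by rewrite d_half muln1; apply: edge_counts_lower_bound.
Qed.
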